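(* Let $\mu$ be an irreducible, finitely supported, symmetric probability measure on $\mathrm{Homeo}^+(\mathbf{R})$, and let $P$ be the associated transition operator. Then there exists a nonzero $P$-invariant Radon measure on the real line.
   Context: $\mathrm{Homeo}^+(\mathbf{R})$ is the group of orientation-preserving (increasing) homeomorphisms of the real line, and $G$ denotes the group generated by the support of $\mu$. The measure $\mu$ is symmetric if $\mu(g)=\mu(g^{-1})$ for all $g$, and irreducible if $G$ has no global fixed point, i.e. for every $x\in\mathbf{R}$ there is $g\in G$ with $g(x)\neq x$. The transition operator is $P\varphi(x)=\sum_{g}\mu(g)\varphi(g(x))$; it acts by duality on (positive) Radon measures, so a Radon measure $\nu$ on $\mathbf{R}$ is $P$-invariant if $\nu=\sum_{g}\mu(g)\,g_{\star}\nu$, equivalently $\int P\varphi\,d\nu=\int\varphi\,d\nu$ for every compactly supported continuous $\varphi$. *)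

(* Defs.v *)
From HB Require Import structures.
From mathcomp Require Import all_boot all_order all_algebra.
From mathcomp Require Import all_classical all_reals all_analysis measurable_realfun.

Set Implicit Arguments.
Unset Strict Implicit.
Unset Printing Implicit Defensive.

Import Order.TTheory GRing.Theory Num.Theory.
Import numFieldNormedType.Exports.

Local Open Scope classical_set_scope.
Local Open Scope ring_scope.

Record homeo (R : realType) := Homeo {
  homeo_fun :> R -> R ;
  homeo_inv : R -> R ;
  homeo_funK : cancel homeo_fun homeo_inv ;
  homeo_invK : cancel homeo_inv homeo_fun ;
  homeo_continuous : continuous homeo_fun ;
  homeo_inv_continuous : continuous homeo_inv ;
  homeo_increasing : {homo homeo_fun : x y / x < y} }.

Section homeo_group.
Context {R : realType}.
Implicit Types f g h : homeo R.

(* The inverse is stored as data, but it is determined by the function. *)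
Lemma homeo_eq f g : f =1 g -> f = g.
Proof.
case: f => f f' fK f'K cf cf' incf; case: g => g g' gK g'K cg cg' incg /= fg.
have {}fg : f = g by apply/funext.
subst g.
have f'g' : f' = g' by apply/funext => x; rewrite -{2}(f'K x) gK.
subst g'.
by congr Homeo; exact: Prop_irrelevance.
Qed.

Definition homeo_id : homeo R :=
  @Homeo R idfun idfun (fun=> erefl) (fun=> erefl)
    (fun x => @cvg_id _ (nbhs x)) (fun x => @cvg_id _ (nbhs x)) (fun _ _ => id).

Lemma homeo_comp_continuous f g : continuous (f \o g).
Proof. by move=> x; apply: continuous_comp; exact: homeo_continuous. Qed.

Lemma homeo_comp_inv_continuous f g :
  continuous (homeo_inv g \o homeo_inv f).
Proof. by move=> x; apply: continuous_comp; exact: homeo_inv_continuous. Qed.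

Lemma homeo_comp_increasing f g : {homo f \o g : x y / x < y}.
Proof. by move=> x y xy /=; do 2!apply: homeo_increasing. Qed.

Definition homeo_comp f g : homeo R :=
  Homeo (can_comp (homeo_funK f) (homeo_funK g))
        (can_comp (homeo_invK g) (homeo_invK f))
        (@homeo_comp_continuous f g) (@homeo_comp_inv_continuous f g)
        (@homeo_comp_increasing f g).

Lemma homeo_inv_increasing f : {homo homeo_inv f : x y / x < y}.
Proof.
move=> x y xy; rewrite ltNge; apply/negP; rewrite le_eqVlt => /predU1P[e|].
  by move: xy; rewrite -(homeo_invK f x) -e homeo_invK ltxx.
by move/(homeo_increasing f); rewrite !homeo_invK => /(lt_trans xy); rewrite ltxx.
Qed.

Definition homeo_opp f : homeo R :=
  Homeo (homeo_invK f) (homeo_funK f)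
        (@homeo_inv_continuous _ f) (@homeo_continuous _ f)
        (@homeo_inv_increasing f).

HB.instance Definition _ := gen_eqMixin (homeo R).
HB.instance Definition _ := gen_choiceMixin (homeo R).

Let homeo_compA : associative homeo_comp.
Proof. by move=> f g h; exact: homeo_eq. Qed.

Let homeo_comp1f : left_id homeo_id homeo_comp.
Proof. by move=> f; exact: homeo_eq. Qed.

Let homeo_compf1 : right_id homeo_id homeo_comp.
Proof. by move=> f; exact: homeo_eq. Qed.

Let homeo_compVf : left_inverse homeo_id homeo_opp homeo_comp.
Proof. by move=> f; apply: homeo_eq => x /=; rewrite homeo_funK. Qed.

Let homeo_compfV : right_inverse homeo_id homeo_opp homeo_comp.
Proof. by move=> f; apply: homeo_eq => x /=; rewrite homeo_invK. Qed.

HB.instance Definition _ := isGroup.Build (homeo R)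
  homeo_compA homeo_comp1f homeo_compf1 homeo_compVf homeo_compfV.

Lemma homeoME f g (x : R) : (f * g)%g x = f (g x). Proof. by []. Qed.

End homeo_group.

Definition generated_group (G : groupType) (A : set G) : set G :=
  smallest (fun H : set G => group_closed (mem H)) A.

Section random_walk.
Context {R : realType}.
Local Notation Borel := (measurableTypeR R).
Implicit Types (mu : homeo R -> R) (nu : {measure set Borel -> \bar R}).

Definition mass_support mu : set (homeo R) := [set g | mu g != 0].

(* A finitely supported measure on the group is given by the masses of its    *)
(* points. The sum below would be 0 by convention on an infinite support.     *)
Definition finitely_supported_probability mu :=
  [/\ forall g, 0 <= mu g, finite_set (mass_support mu) &
      \sum_(g \in mass_support mu) mu g = 1].

Definition symmetric_measure mu := forall g, mu g = mu (g^-1)%g.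

Definition irreducible_measure mu :=
  forall x : R, exists2 g, generated_group (mass_support mu) g & g x <> x.

Definition transition mu (phi : R -> R) (x : R) : R :=
  \sum_(g \in mass_support mu) mu g * phi (g x).

Definition dual_transition mu nu (A : set Borel) : \bar R :=
  (\sum_(g \in mass_support mu)
     (mu g)%:E * pushforward nu (g : Borel -> Borel) A)%E.

Definition invariant_measure mu nu :=
  forall A : set Borel, measurable A -> nu A = dual_transition mu nu A.

Definition radon_measure nu :=
  [/\ forall K : set R, compact K -> (nu K < +oo)%E,
      forall A : set Borel, measurable A ->
        nu A = ereal_inf [set nu U | U in [set U : set R | open U /\ A `<=` U]] &
      forall U : set R, open U ->
        nu U = ereal_sup [set nu K | K in [set K : set R | compact K /\ K `<=` U]]].

Lemma measurable_homeo (g : homeo R) :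
  measurable_fun [set: Borel] (g : Borel -> Borel).
Proof. by apply: continuous_measurable_fun => x; exact: homeo_continuous. Qed.

Lemma integral_transition_indic mu nu (A : set Borel) :
  finitely_supported_probability mu -> measurable A ->
  (\int[nu]_x (transition mu \1_A x)%:E)%E = dual_transition mu nu A.
Proof.
move=> [mu0 fmu _] mA.
have mgA (g : homeo R) : measurable ((g : Borel -> Borel) @^-1` A).
  by rewrite -[X in measurable X]setTI; exact: measurable_homeo.
under eq_integral => x _.
  rewrite /transition -fsumEFin//.
  under eq_fsbigr => g _ do rewrite EFinM -[\1_A (g x)]/(\1_(g @^-1` A) x).
  over.
rewrite ge0_integral_fsum//=; last 2 first.
- move=> g; apply: measurable_funeM.
  by apply/measurable_EFinP; exact: measurable_indic.
- by move=> g x _; rewrite -EFinM lee_fin mulr_ge0.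
apply: eq_fsbigr => g _.
rewrite ge0_integralZl//=.
- by rewrite integral_indic// setIT.
- by apply/measurable_EFinP; exact: measurable_indic.
- by rewrite lee_fin.
Qed.

End random_walk.

(* Main.v *)
(** Take [a < b] such that no generator maps [a] to the right of [b]: every
  orbit, being unbounded in both directions, then meets [`]a, b[]. For
  [0 < l < 1] and a point [m], the resolvent [F = \sum_k l^k P^k H] of the step
  function [H = 1_[m, +oo[] is nondecreasing and solves [F = H + l P F], so its
  increment over [`]g x, g y]] is at most a constant, depending only on [g] in
  the group, times its increment over [`]x, y]]. Normalized by
  [F a = 0] and [F b = 1], such functions are therefore bounded at each point
  independently of [l >= 1/2] and [m]. A pointwise limit along an ultrafilter,
  as [l -> 1] and [m -> +oo], is nondecreasing, not constant, and [P F - F] is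
  constant. Since [mu] is symmetric, this says precisely that the
  Lebesgue-Stieltjes measure of its right-continuous version is invariant. *)
Require Import Defs.
From HB Require Import structures.
From mathcomp Require Import all_boot all_order all_algebra.
From mathcomp Require Import all_classical all_reals all_analysis measurable_realfun.
From mathcomp Require Import ring lra.

Set Implicit Arguments.
Unset Strict Implicit.
Unset Printing Implicit Defensive.

Import Order.TTheory GRing.Theory Num.Theory.
Import numFieldNormedType.Exports.

Local Open Scope classical_set_scope.
Local Open Scope ring_scope.

(** * Generated subgroups and the order on the line *)

Section generated_group_theory.
Context {R : realType} (A : set (homeo R)).

Lemma generated_group_ind (Q : homeo R -> Prop) :
  Q 1%g -> (forall g h, Q g -> Q h -> Q (g * h^-1)%g) -> A `<=` Q ->
  generated_group A `<=` Q.
Proof.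
move=> Q1 Qd AQ; apply: (smallest_sub (X := [set g | Q g])) => //.
split; first by rewrite inE.
by move=> g h; rewrite !inE; exact: Qd.
Qed.

Lemma sub_generated_group : A `<=` generated_group A.
Proof. by move=> g Ag H [_]; exact. Qed.

Lemma generated_group1 : generated_group A 1%g.
Proof. by move=> H /= [[+ _] _]; rewrite inE. Qed.

Lemma generated_groupM g h :
  generated_group A g -> generated_group A h -> generated_group A (g * h)%g.
Proof.
move=> gg gh H HA; have [/= [_ Hd] _] := HA; move: (HA.1) => /= [H1 _].
have HV k : H k -> H (k^-1)%g.
  by move=> Hk; rewrite -[X in H X]mul1g; have := Hd 1%g k; rewrite !inE;
    apply=> //; rewrite inE in H1.
have := Hd g (h^-1)%g; rewrite !inE invgK; apply; first exact: gg.
by apply: HV; exact: gh.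
Qed.

Lemma generated_groupV g : generated_group A g -> generated_group A (g^-1)%g.
Proof.
move=> gg H HA; have [/= [+ Hd] _] := HA; rewrite inE => H1.
rewrite -[X in H X]mul1g; have := Hd 1%g g; rewrite !inE.
by apply => //; exact: gg.
Qed.

End generated_group_theory.

Section homeo_order.
Context {R : realType}.
Implicit Types g : homeo R.

Lemma homeo_ltE g x y : (g x < g y) = (x < y).
Proof.
apply/idP/idP; last exact: homeo_increasing.
move=> gxy; rewrite ltNge le_eqVlt; apply/negP => /predU1P[e|].
  by rewrite e ltxx in gxy.
by move=> /(homeo_increasing g) /(lt_trans gxy); rewrite ltxx.
Qed.

Lemma homeo_leE g x y : (g x <= g y) = (x <= y).
Proof. by rewrite !leNgt homeo_ltE. Qed.

Lemma homeo_mulVE g x : (g^-1)%g (g x) = x. Proof. exact: homeo_funK. Qed.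

Lemma homeo_mulEV g x : g ((g^-1)%g x) = x. Proof. exact: homeo_invK. Qed.

End homeo_order.

(** * Orbits of the generated group *)

Section orbits.
Context {R : realType} (mu : homeo R -> R).
Hypothesis mu_sym : symmetric_measure mu.
Hypothesis mu_irr : irreducible_measure mu.
Let G := generated_group (mass_support mu).

Lemma mass_supportV g : mass_support mu g -> mass_support mu (g^-1)%g.
Proof. by rewrite /mass_support /= -mu_sym. Qed.

(** If the orbit were bounded above, its supremum would be a global fixed point: each [g] and its
    inverse map it to a point not above itself. *)
Lemma orbit_unbounded_above a x : exists2 g, G g & a < g x.
Proof.
apply: contrapT => H; pose O := [set g x | g in G].
have Oub : ubound O a.
  move=> _ [g Gg <-]; rewrite leNgt; apply/negP => agx; apply: H; by exists g.
have O0 : O !=set0 by exists x; exists 1%g => //; exact: generated_group1.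
have hO : has_ubound O by exists a.
have supG g : G g -> g (sup O) <= sup O.
  move=> Gg; rewrite -(homeo_leE (g^-1)%g) homeo_mulVE.
  apply: ge_sup => // _ [h Gh <-]; rewrite -(homeo_leE g) homeo_mulEV.
  apply: ub_le_sup => //; exists (g * h)%g => //; exact: generated_groupM.
have [g Gg] := mu_irr (sup O); apply; apply/eqP; rewrite eq_le supG//=.
rewrite -(homeo_leE (g^-1)%g) homeo_mulVE; apply: supG; exact: generated_groupV.
Qed.

Lemma orbit_unbounded_below a x : exists2 g, G g & g x < a.
Proof.
apply: contrapT => H; pose O := [set g x | g in G].
have Olb : lbound O a.
  move=> _ [g Gg <-]; rewrite leNgt; apply/negP => agx; apply: H; by exists g.
have O0 : O !=set0 by exists x; exists 1%g => //; exact: generated_group1.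
have hO : has_lbound O by exists a.
have infG g : G g -> inf O <= g (inf O).
  move=> Gg; rewrite -(homeo_leE (g^-1)%g) homeo_mulVE.
  apply: lb_le_inf => // _ [h Gh <-]; rewrite -(homeo_leE g) homeo_mulEV.
  apply: ge_inf => //; exists (g * h)%g => //; exact: generated_groupM.
have [g Gg] := mu_irr (inf O); apply; apply/eqP; rewrite eq_le infG// andbT.
rewrite -(homeo_leE (g^-1)%g) homeo_mulVE; apply: infG; exact: generated_groupV.
Qed.

(* Going from below [a] to above [a], the orbit cannot jump over [`]a, b[]. *)
Lemma orbit_meets a b x : (forall g, mass_support mu g -> g a < b) ->
  exists2 g, G g & a < g x < b.
Proof.
move=> ab; apply: contrapT => H.
(* A generator sends []-oo, a]] below [b], so an orbit avoiding []a, b[] must land in []-oo, a]]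
   again. *)
have cross g s : G g -> mass_support mu s -> g x <= a -> s (g x) <= a.
  move=> Gg ss gxa; rewrite leNgt; apply/negP => asgx; apply: H.
  exists (s * g)%g; first exact: generated_groupM (sub_generated_group ss) Gg.
  by rewrite homeoME asgx /= (le_lt_trans _ (ab _ ss))// homeo_leE.
(* An equivalence, unlike an implication, passes to inverses. For a generator the converse is
   [cross] for its inverse, which lies in the support by symmetry. *)
have stable h : G h -> forall g, G g -> (h (g x) <= a) = (g x <= a).
  pose Q h := G h /\ forall g, G g -> (h (g x) <= a) = (g x <= a).
  have GQ : G `<=` Q.
    apply: generated_group_ind.
    - by split; first exact: generated_group1.
    - move=> g k [Gg gQ] [Gk kQ]; have GV := generated_groupV Gk.
      split; first exact: generated_groupM.
      move=> l Gl; have Gkl := generated_groupM GV Gl.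
      by rewrite [LHS](gQ _ Gkl) -(kQ _ Gkl) homeoME homeo_mulEV.
    - move=> s ss; have Gs := sub_generated_group ss; split=> // g Gg.
      apply/idP/idP; last exact: cross.
      move=> sgx; rewrite -(homeo_mulVE s (g x)).
      by apply: (cross (s * g)%g); [exact: generated_groupM|exact: mass_supportV|].
  by move=> Gh; have [] := GQ h Gh.
have [g Gg /ltW gxa] := orbit_unbounded_below a x.
have [h Gh] := orbit_unbounded_above a (g x).
by rewrite ltNge stable// gxa.
Qed.

End orbits.

(** * The transition operator and its resolvents *)

Section transition_theory.
Context {R : realType} (mu : homeo R -> R).
Hypothesis mu_prob : finitely_supported_probability mu.
Implicit Types (F : R -> R) (l : R).

Let mu_ge0 g : 0 <= mu g. Proof. by case: mu_prob. Qed.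
Let supp_fin : finite_set (mass_support mu). Proof. by case: mu_prob. Qed.
Let s := finmap.enum_fset (fset_set (mass_support mu)).

Lemma mass_support_gt0 g : mass_support mu g -> 0 < mu g.
Proof. by move=> /eqP g0; rewrite lt_neqAle mu_ge0 andbT eq_sym; apply/eqP. Qed.

Let transitionE F x : transition mu F x = \sum_(g <- s) mu g * F (g x).
Proof. exact: fsbig_finite. Qed.

Lemma transition_cst c x : transition mu (fun=> c) x = c.
Proof.
rewrite transitionE -mulr_suml -fsbig_finite//.
by have [_ _ ->] := mu_prob; rewrite mul1r.
Qed.

Lemma transition_affine F c d x :
  transition mu (fun y => (F y - d) * c) x = (transition mu F x - d) * c.
Proof.
rewrite -[in RHS](transition_cst d x) !transitionE -sumrB mulr_suml.
by apply: eq_bigr => g _; rewrite -mulrBr mulrA.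
Qed.

Lemma le_transition F F' x : (forall y, F y <= F' y) ->
  transition mu F x <= transition mu F' x.
Proof. by move=> FF'; rewrite !transitionE ler_sum// => g _; rewrite ler_wpM2l. Qed.

(** The increment of [P F] is a sum of nonnegative terms, hence at least any single one of them. *)
Lemma transition_increment_ge F g x y :
  {homo F : x y / x <= y} -> mass_support mu g -> x <= y ->
  mu g * (F (g y) - F (g x)) <= transition mu F y - transition mu F x.
Proof.
move=> ndF sg xy; rewrite !transitionE -sumrB.
rewrite (bigD1_seq g) ?finmap.fset_uniq//=; last by rewrite in_fset_set// inE.
rewrite -mulrBr lerDl sumr_ge0// => h _.
by rewrite -mulrBr mulr_ge0// subr_ge0 ndF// homeo_leE.
Qed.

Lemma transition_homo F :
  {homo F : x y / x <= y} -> {homo transition mu F : x y / x <= y}.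
Proof.
move=> ndF x y xy; rewrite !transitionE ler_sum// => g _.
by rewrite ler_wpM2l// ndF// homeo_leE.
Qed.

(** The sum is finite. Families indexed by group elements cover both later uses: a varying function
    at a fixed point, and a fixed function at a moving point. *)
Lemma cvg_transition {T : Type} (U : set_system T) {UF : Filter U}
    (u : T -> homeo R -> R) (v : homeo R -> R) :
  (forall g, u t g @[t --> U] --> v g) ->
  \sum_(g \in mass_support mu) mu g * u t g @[t --> U] -->
    \sum_(g \in mass_support mu) mu g * v g.
Proof.
move=> uv; rewrite fsbig_finite//.
rewrite (_ : (fun t => _) = fun t => \sum_(g <- s) mu g * u t g); last first.
  by apply/funext => t; rewrite fsbig_finite.
rewrite -/s; elim: s => [|g r IH].
  rewrite big_nil (_ : (fun t => _) = fun=> 0); first exact: cvg_cst.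
  by apply/funext => t; rewrite big_nil.
rewrite big_cons (_ : (fun t => _) =
  (fun t => mu g * u t g) + (fun t => \sum_(g <- r) mu g * u t g)); last first.
  by apply/funext => t; rewrite big_cons.
by apply: cvgD => //; apply: cvgMr; exact: uv.
Qed.

(** The iterates of [T] from 0 are the partial sums of the resolvent series; they increase and are
    dominated by a geometric series. *)
Lemma green_exists l (H : R -> R) : 0 <= l < 1 ->
  {homo H : x y / x <= y} -> (forall x, 0 <= H x <= 1) ->
  exists2 F, {homo F : x y / x <= y} & forall x, F x = H x + l * transition mu F x.
Proof.
move=> /andP[l0 l1] ndH H01; pose T F x := H x + l * transition mu F x.
pose f n := iter n T (fun=> 0).
have T_le F F' : (forall y, F y <= F' y) -> forall y, T F y <= T F' y.
  by move=> FF' y; rewrite lerD2l ler_wpM2l// le_transition.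
have fS n x : f n x <= f n.+1 x.
  elim: n x => [|n IH] x; last exact: T_le.
  by rewrite /f/= /T transition_cst mulr0 addr0; case/andP: (H01 x).
have fB n x : f n x <= (1 - l)^-1.
  elim: n x => [|n IH] x; first by rewrite /f/= invr_ge0 subr_ge0 ltW.
  (* [(1 - l)^-1] is the fixed point of [t = 1 + l * t], so the bound propagates. *)
  apply: (@le_trans _ _ (1 + l * (1 - l)^-1)).
    apply: lerD; first by case/andP: (H01 x).
    rewrite ler_wpM2l// -[leRHS](transition_cst _ x); exact: le_transition.
  have l10 : 1 - l != 0 by rewrite subr_eq0 gt_eqF.
  by rewrite -{1}(divff l10) -mulrDl subrK mul1r.
have fcvg x : f n x @[n --> \oo] --> limn (f ^~ x).
  apply: nondecreasing_is_cvgn; first exact/nondecreasing_seqP.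
  by exists (1 - l)^-1 => _ [n _ <-].
have fnd n : {homo f n : x y / x <= y}.
  elim: n => // n IH x y xy; rewrite /f/= lerD ?ndH// ler_wpM2l//.
  exact: transition_homo.
exists (fun x => limn (f ^~ x)) => [x y xy|x].
  apply: ler_lim; [exact: fcvg|exact: fcvg|].
  by apply: nearW => n; exact: fnd.
apply/cvg_lim => //; rewrite -(cvg_shiftS (f ^~ x)) /=.
apply: cvgD; first exact: cvg_cst.
apply: cvgMr; apply: cvg_transition => g; exact: fcvg.
Qed.

End transition_theory.

(** By compactness of [[- M, M]] the image of [U] has a cluster point, and an ultrafilter converges
    to each of its cluster points. *)
Lemma ultra_bounded_cvg {R : realType} {T : Type} (U : set_system T)
    (f : T -> R) (M : R) :
  UltraFilter U -> (forall t, `|f t| <= M) -> cvg (f t @[t --> U]).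
Proof.
move=> UU fM; have UP : ProperFilter U by exact: ultra_proper.
have [|p [_ pcl]] := @segment_compact R (- M) M (f @ U).
  by apply: (@filterE _ U _ (f @^-1` `[- M, M])) => t /=; rewrite in_itv/= -ler_norml.
apply/cvg_ex; exists p => A pA; rewrite /nbhs/=.
have [//|UnA] := in_ultra_setVsetC (f @^-1` A) UU.
by have [y [nAy Ay]] := pcl (~` A) A UnA pA.
Qed.

(** * Harnack inequalities and the limit function *)

Section invariant_function.
Context {R : realType} (mu : homeo R -> R).
Hypothesis mu_prob : finitely_supported_probability mu.
Hypothesis mu_sym : symmetric_measure mu.
Hypothesis mu_irr : irreducible_measure mu.
Let G := generated_group (mass_support mu).
Implicit Types F : R -> R.

(* Satisfied uniformly in [1/2 <= l < 1] by the resolvents [\sum_k l^k P^k H]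
   of nondecreasing functions [H]. *)
Definition harnack F :=
  {homo F : x y / x <= y} /\
  forall g x y, mass_support mu g -> x <= y ->
    mu g * (F (g y) - F (g x)) <= 2 * (F y - F x).

(** As [H] is nondecreasing, [l] times the increment of [P F] is at most that of [F]; dividing by
    [l] costs a factor of at most 2. *)
Lemma harnack_resolvent l (H F : R -> R) : 2^-1 <= l ->
  {homo H : x y / x <= y} -> {homo F : x y / x <= y} ->
  (forall x, F x = H x + l * transition mu F x) -> harnack F.
Proof.
move=> l2 ndH ndF FE; split=> // g x y sg xy.
have := transition_increment_ge mu_prob ndF sg xy.
have := ndH _ _ xy; have := transition_homo mu_prob ndF xy.
rewrite [in X in _ -> _ -> _ -> _ <= X](FE x) (FE y).
set d := mu g * _ ; set p := transition mu F x; set q := transition mu F y.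
move=> pq Hxy dpq; apply: le_trans dpq _.
have : 2^-1 * (q - p) <= l * (q - p) by rewrite ler_wpM2r// subr_ge0.
lra.
Qed.

(** Constants multiply under composition. It matters that [C] is chosen before [F]. *)
Lemma harnack_group g : G g -> exists2 C, 0 < C & forall F, harnack F ->
  forall x y, x <= y -> F (g y) - F (g x) <= C * (F y - F x).
Proof.
pose Q (g : homeo R) := exists2 C, 0 < C & forall F, harnack F ->
  forall x y, x <= y -> F (g y) - F (g x) <= C * (F y - F x).
have QM g' h : Q g' -> Q h -> Q (g' * h)%g.
  move=> [C C0 gC] [D D0 hD]; exists (C * D); first exact: mulr_gt0.
  move=> F FH x y xy; rewrite !homeoME -mulrA.
  apply: (le_trans (gC F FH (h x) (h y) _)); first by rewrite homeo_leE.
  by rewrite ler_pM2l//; exact: hD.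
have Qs s : mass_support mu s -> Q s.
  move=> ss; have s0 := mass_support_gt0 mu_prob ss.
  exists (2 / mu s) => [|F [_ FH] x y xy]; first exact: divr_gt0.
  by rewrite mulrAC ler_pdivlMr// mulrC; exact: FH.
suff : G `<=` [set g | Q g /\ Q (g^-1)%g] by move=> GQ Gg; have [] := GQ g Gg.
apply: generated_group_ind.
- have Q1 : Q 1%g by exists 1 => // F _ x y _; rewrite mul1r.
  by rewrite /= invg1.
- move=> g' h [Qg QgV] [Qh QhV]; rewrite /= invgM invgK.
  by split; exact: QM.
- by move=> s ss; split; apply: Qs => //; exact: mass_supportV.
Qed.

(** Connectedness of the line: the points where such a [C] exists form an open and closed set
    containing [a]. *)
Lemma harnack_bound a b x : a < b -> (forall g, mass_support mu g -> g a < b) ->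
  exists C, forall F, harnack F -> `|F x - F a| <= C * (F b - F a).
Proof.
move=> ab sab.
(* Some [g] brings [z] into []a, b[], so the preimage of []a, b[] is a neighbourhood of [z], and the
   increment of [F] across it is controlled by that across []a, b[]. *)
have loc z : exists D, \forall y \near z, forall F, harnack F ->
    `|F y - F z| <= D * (F b - F a).
  have [g Gg /andP[agz gzb]] := orbit_meets mu_sym mu_irr z sab.
  have [D D0 gD] := harnack_group (generated_groupV Gg).
  exists D; have : z \in `](g^-1)%g a, (g^-1)%g b[.
    by rewrite in_itv/= -(homeo_ltE g) homeo_mulEV agz -(homeo_ltE g) homeo_mulEV.
  move=> zab; near=> y => F FH; have [ndF _] := FH.
  apply: le_trans (gD F FH a b (ltW ab)).
  have : y \in `](g^-1)%g a, (g^-1)%g b[.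
    by near: y; exact: near_in_itvoo.
  have := zab; rewrite !in_itv/= => /andP[/ltW/ndF az /ltW/ndF zb] /andP[/ltW/ndF ay /ltW/ndF yb].
  by rewrite ler_norml; apply/andP; split; lra.
pose E := [set z | exists C, forall F, harnack F -> `|F z - F a| <= C * (F b - F a)].
suff : E = setT by move=> ET; have : E x by rewrite ET.
have shift u v D : (forall F, harnack F -> `|F v - F u| <= D * (F b - F a)) ->
    E u -> E v.
  move=> uv [C uC]; exists (D + C) => F FH; rewrite mulrDl.
  rewrite -(subrKA (F u) (F v)); apply: (le_trans (ler_normD _ _)).
  by apply: lerD; [exact: uv|exact: uC].
have oE : open E.
  rewrite openE => z Ez; have [D zD] := loc z.
  by rewrite /interior; near=> y; apply: (shift z y D) => //; near: y.
have cE : closed E.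
  rewrite -openC openE => z nEz; have [D zD] := loc z.
  rewrite /interior; near=> y => Ey; apply: nEz; apply: (shift y z D) => //.
  by move=> F FH; rewrite distrC; move: F FH; near: y.
have /connected_intervalP : is_interval [set: R] by [].
apply; last 2 first.
- by exists E => //; rewrite setTI.
- by exists E => //; rewrite setTI.
by exists a, 0 => F _; rewrite subrr normr0 mul0r.
Unshelve. all: by end_near. Qed.

(** The parameter [1 - m.+2%:R^-1] stays in [[1/2, 1[] for every [m], including 0, and tends to
    1. *)
Lemma resolvent_exists a b m : (forall g, mass_support mu g -> g a < b) ->
  exists F, [/\ harnack F, F a < F b &
    forall x, F x = (m%:R <= x)%R%:R + (1 - m.+2%:R^-1) * transition mu F x].
Proof.
move=> sab; pose H (x : R) : R := (m%:R <= x)%R%:R.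
have ndH : {homo H : x y / x <= y}.
  by move=> x y xy; rewrite /H ler_nat; case: leP => // mx; rewrite (le_trans mx).
have l2 : 2^-1 <= 1 - m.+2%:R^-1 :> R.
  have : (m.+2%:R^-1 : R) <= 2^-1 by rewrite lef_pV2 ?posrE// ler_nat.
  by move: (m.+2%:R^-1 : R) => t; lra.
have [||F ndF FE] := green_exists mu_prob (l := 1 - m.+2%:R^-1) _ ndH.
- by rewrite (le_trans _ l2)//= ltrBlDr ltrDl.
- by move=> x; rewrite /H; case: (m%:R <= x)%R; rewrite ?lexx ?ler01.
have FH := harnack_resolvent l2 ndH ndF FE.
exists F; split=> //.
(* The jump of [H] at [m] makes [F] increase strictly across the preimage of []a, b[] by [g], hence
   across []a, b[] itself by the Harnack inequality. *)
have [g Gg /andP[agm gmb]] := orbit_meets mu_sym mu_irr m%:R sab.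
have [C C0 gC] := harnack_group (generated_groupV Gg).
have ab := lt_trans agm gmb.
have := gC F FH a b (ltW ab).
rewrite -subr_gt0 -(pmulr_rgt0 _ C0); apply: lt_le_trans.
have Va : (g^-1)%g a < m%:R by rewrite -(homeo_ltE g) homeo_mulEV.
have Vb : m%:R < (g^-1)%g b by rewrite -(homeo_ltE g) homeo_mulEV.
rewrite subr_gt0 (FE ((g^-1)%g a)) (FE ((g^-1)%g b)) /H (ltW Vb) leNgt Va/= add0r.
rewrite ltr_pwDl// ler_wpM2l//; first by apply: le_trans l2.
by apply: transition_homo => //; apply: ltW; exact: lt_trans Va Vb.
Qed.

Lemma invariant_function_exists : exists F (a b : R),
  [/\ {homo F : x y / x <= y}, F a < F b &
      forall x, transition mu F x - F x = transition mu F a - F a].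
Proof.
pose a : R := 0.
have [b ab sab] : exists2 b, a < b & forall g, mass_support mu g -> g a < b.
  have [_ fs _] := mu_prob.
  have [M [Mreal Mb]] : bounded_set [set g a | g in mass_support mu].
    by apply: compact_bounded; apply: finite_compact; exact: finite_image.
  (* Only reals strictly above [M] are known to be bounds: one half ensures this, the other half
     makes [g a < b] strict. *)
  exists (`|M| + 1) => [|g sg]; first by rewrite ltr_wpDl.
  rewrite (le_lt_trans (ler_norm _))//.
  rewrite (@le_lt_trans _ _ (`|M| + 2^-1))//; last by rewrite ltrD2l; lra.
  apply: Mb; last by exists g.
  by rewrite (le_lt_trans (ler_norm M))// ltrDl.
have /choice[F FP] := fun m => resolvent_exists m sab.
pose c m := F m b - F m a; pose N m x := (F m x - F m a) / c m.
have c0 m : 0 < c m by rewrite subr_gt0; case: (FP m).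
have [U [UU ooU]] := ultraFilterLemma (eventually_filter : ProperFilter \oo).
have UP : ProperFilter U by exact: ultra_proper.
have Ncvg x : N m x @[m --> U] --> lim (N m x @[m --> U]).
  have [C CP] := harnack_bound x ab sab.
  apply: (@ultra_bounded_cvg _ _ _ _ C) => m.
  rewrite /N normrM normfV (gtr0_norm (c0 m)) ler_pdivrMr//.
  by apply: CP; case: (FP m).
pose L x := lim (N m x @[m --> U]).
have La : L a = 0.
  apply/cvg_lim => //; rewrite (_ : (fun m => _) = fun=> 0); first exact: cvg_cst.
  by apply/funext => m; rewrite /N subrr mul0r.
have Lb : L b = 1.
  apply/cvg_lim => //; rewrite (_ : (fun m => _) = fun=> 1); first exact: cvg_cst.
  by apply/funext => m; rewrite /N -/(c m) divff// gt_eqF.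
have PNcvg x : transition mu (N m) x @[m --> U] --> transition mu L x.
  apply: (cvg_transition mu_prob (u := fun m g => N m (g x)) (v := fun g => L (g x))).
  by move=> g; exact: Ncvg.
exists L, a, b; split; last 1 first.
- move=> x; rewrite La subr0; apply/eqP; rewrite subr_eq addrC -subr_eq; apply/eqP.
  pose l m : R := 1 - m.+2%:R^-1.
  have lcvg : l m @[m --> U] --> (1 : R).
    apply: (@cvg_trans _ (l m @[m --> \oo])); first by apply: cvg_app; exact: ooU.
    have h0 : (m.+2%:R^-1 : R) @[m --> \oo] --> 0.
      by have := @cvg_harmonic R; rewrite -(cvg_shiftS (@harmonic R)).
    by have := cvgB (cvg_cst (1 : R)) h0; rewrite subr0; exact.
  (* Subtracting the resolvent equations at [x] and [a] identifies this sequence with [N m x] once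
     [m] exceeds both points, where the step function vanishes. *)
  have : l m * (transition mu (N m) x - transition mu (N m) a) @[m --> U] -->
      1 * (transition mu L x - transition mu L a).
    by apply: cvgM => //; apply: cvgB.
  rewrite mul1r => /(cvg_lim (@Rhausdorff R)) <-.
  apply/cvg_lim => //.
  apply: cvg_trans (Ncvg x); apply: near_eq_cvg.
  apply: ooU; near=> m.
  have [_ _ FE] := FP m.
  have mx : x < m%:R by near: m; exact: nbhs_infty_gtr.
  have ma : a < m%:R by near: m; exact: nbhs_infty_gtr.
  rewrite /N !transition_affine// -mulrBl mulrA; congr (_ / _).
  rewrite (FE x) (FE a) !leNgt mx ma/= !add0r.
  by rewrite /l; ring.
- move=> x y xy; apply: ler_lim; [exact: Ncvg|exact: Ncvg|].
  apply: nearW => m; rewrite /N ler_pM2r ?invr_gt0// lerD2r.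
  by have [[ndF _] _ _] := FP m; exact: ndF.
- by rewrite La Lb.
Unshelve. all: by end_near. Qed.

End invariant_function.

(** * Right-continuous regularization *)

Section right_limit.
Context {R : realType} (F : R -> R).
Hypothesis ndF : {homo F : x y / x <= y}.

Definition right_limit (x : R) : R := inf [set F z | z in `]x, +oo[].

Let has_inf_right x : has_inf [set F z | z in `]x, +oo[].
Proof.
split; first by exists (F (x + 1)), (x + 1) => //=; rewrite in_itv/= andbT ltrDl.
exists (F x) => _ [z /= + <-]; rewrite in_itv/= andbT => /ltW; exact: ndF.
Qed.

Lemma right_limit_ge x : F x <= right_limit x.
Proof.
apply: lb_le_inf; first by case: (has_inf_right x).
by move=> _ [z /= + <-]; rewrite in_itv/= andbT => /ltW; exact: ndF.
Qed.

Lemma right_limit_le x y : x < y -> right_limit x <= F y.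
Proof.
move=> xy; apply: ge_inf; first by case: (has_inf_right x).
by exists y => //=; rewrite in_itv/= andbT.
Qed.

Lemma right_limit_homo : {homo right_limit : x y / x <= y}.
Proof.
move=> x y; rewrite le_eqVlt => /predU1P[->//|xy].
exact: le_trans (right_limit_le xy) (right_limit_ge y).
Qed.

(** [g] maps []x, +oo[] onto []g x, +oo[], so both sides are governed by the same infimum. *)
Lemma cvg_right_limit (g : homeo R) x :
  F (g z) @[z --> x^'+] --> right_limit (g x).
Proof.
rewrite (_ : right_limit (g x) = inf [set (F \o g) z | z in `]x, +oo[]); last first.
  congr inf; apply/seteqP; split=> [_ [z /= + <-]|_ [z /= + <-]];
    rewrite in_itv/= andbT => xz.
  - exists ((g^-1)%g z); last by rewrite /= homeo_invK.
    by rewrite /= in_itv/= andbT -(homeo_ltE g) homeo_mulEV.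
  - by exists (g z) => //=; rewrite in_itv/= andbT homeo_ltE.
apply: nondecreasing_at_right_cvgr => //.
- by move=> y z _ _ yz /=; rewrite ndF// homeo_leE.
- exists (F (g x)) => _ [z /= + <-]; rewrite in_itv/= andbT => /ltW xz.
  by rewrite ndF// homeo_leE.
Qed.

Lemma right_continuous_right_limit x : right_limit z @[z --> x^'+] --> right_limit x.
Proof.
suff -> : right_limit x = inf [set right_limit z | z in `]x, +oo[].
  apply: nondecreasing_at_right_cvgr => //; first by move=> y z _ _; exact: right_limit_homo.
  exists (right_limit x) => _ [z /= + <-]; rewrite in_itv/= andbT => /ltW.
  exact: right_limit_homo.
apply/eqP; rewrite eq_le; apply/andP; split; apply: lb_le_inf.
- by exists (right_limit (x + 1)), (x + 1) => //=; rewrite in_itv/= andbT ltrDl.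
- move=> _ [z /= + <-]; rewrite in_itv/= andbT => /ltW; exact: right_limit_homo.
- by case: (has_inf_right x).
- move=> _ [z /= + <-]; rewrite in_itv/= andbT => xz.
  (* A point strictly between [x] and [z] is needed: [right_limit z] itself may exceed [F z]. *)
  apply: (@le_trans _ _ (right_limit ((x + z) / 2))).
    apply: ge_inf; last by exists ((x + z) / 2) => //=; rewrite in_itv/= andbT midf_lt.
    exists (right_limit x) => _ [t /= + <-]; rewrite in_itv/= andbT => /ltW.
    exact: right_limit_homo.
  by apply: right_limit_le; rewrite midf_lt.
Qed.

End right_limit.

(** The equation holds at every [z > x]; let [z] decrease to [x]. *)
Lemma transition_right_limit {R : realType} (mu : homeo R -> R) (F : R -> R) (c x : R) :
  finitely_supported_probability mu -> {homo F : x y / x <= y} ->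
  (forall x, transition mu F x - F x = c) ->
  transition mu (right_limit F) x - right_limit F x = c.
Proof.
move=> mu_prob ndF FE.
have cP : transition mu F z @[z --> x^'+] --> transition mu (right_limit F) x.
  apply: (cvg_transition mu_prob (u := fun z g => F (g z))
    (v := fun g => right_limit F (g x))) => g.
  exact: cvg_right_limit.
have cF : F z @[z --> x^'+] --> right_limit F x :=
    @cvg_right_limit R F ndF 1%g x.
have := cvg_lim (@Rhausdorff R) (cvgB cP cF) => <-.
rewrite (_ : _ - _ = fun=> c); last by apply/funext => z; exact: FE.
by apply/cvg_lim => //; exact: cvg_cst.
Qed.

(** * Lebesgue-Stieltjes measures are Radon *)

Section stieltjes.
Context {R : realType} (f : cumulative R R).
Local Notation nu := (lebesgue_stieltjes_measure f).

Lemma lebesgue_stieltjes_itv (a b : R) : a <= b -> nu `]a, b] = (f b - f a)%:E.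
Proof.
move=> ab; rewrite -(wlength_itv_bnd f false false ab).
by apply: measurable_mu_extE; exact: is_ocitv.
Qed.

Lemma lebesgue_stieltjes_compact (K : set R) : compact K -> (nu K < +oo)%E.
Proof.
move=> cK; have [M [Mr MK]] := compact_bounded cK.
pose m : R := `|M| + 1.
(* The extra 1 on the left compensates for the open endpoint. *)
have Km : K `<=` `]- (m + 1), m].
  move=> x Kx; have := MK m _ x Kx; rewrite /m ltr_pwDr ?ler_norm// => /(_ isT).
  by rewrite /= in_itv/= ler_norml => /andP[mx ->]; rewrite andbT; lra.
apply: (@le_lt_trans _ _ (nu `]- (m + 1), m])).
  by apply: le_measure => //; rewrite inE//; exact: compact_measurable.
rewrite lebesgue_stieltjes_itv ?ltry//; rewrite /m.
by have := normr_ge0 M; lra.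
Qed.

(** Right continuity of [f] allows the closed endpoint to be pushed slightly to the right at cost
    [e]. *)
Lemma lebesgue_stieltjes_open_cover (I : set R) (e : R) : 0 < e -> ocitv I ->
  exists U : set R, [/\ open U, I `<=` U & (nu U <= wlength f I + e%:E)%E].
Proof.
move=> e0 [[a b] _ <- /=]; have [ba|ab] := leP b a.
  exists set0; split; [exact: open0|by rewrite set_itv_ge// bnd_simp -leNgt|].
  by rewrite measure0 set_itv_ge ?bnd_simp -?leNgt// wlength0 add0e lee_fin ltW.
have [d fd] := nondecreasing_right_continuousP b f e0.
have bd : b < b + d%:num by rewrite ltrDl.
exists `]a, b + d%:num[%classic; split; first exact: interval_open.
  by move=> x; rewrite /= !in_itv/= => /andP[-> /= /le_lt_trans]; apply.
apply: (@le_trans _ _ (nu `]a, b + d%:num])).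
  apply: le_measure => //; rewrite ?inE//.
  by move=> x; rewrite /= !in_itv/= => /andP[-> /= /ltW].
rewrite lebesgue_stieltjes_itv ?(ltW (lt_trans ab bd))// wlength_itv_bnd ?(ltW ab)//.
by rewrite -EFinD lee_fin; lra.
Qed.

Lemma lebesgue_stieltjes_outer (A : set (measurableTypeR R)) : measurable A ->
  nu A = ereal_inf [set nu U | U in [set U : set R | open U /\ A `<=` U]].
Proof.
move=> mA; apply/eqP; rewrite eq_le; apply/andP; split.
  apply: le_ereal_inf_tmp => _ [U [oU AU] <-].
  by apply: le_measure => //; rewrite inE//; exact: open_measurable.
apply/lee_addgt0Pr => e e0; have [Aoo|] := ltP (nu A) +oo%E; last first.
  by rewrite leye_eq => /eqP ->; rewrite addye// leey.
(* [nu] is an infimum over countable covers by half-open intervals. Half of [e] pays for a nearly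
   optimal cover, the other half for opening its members, with geometric weights. *)
have /ereal_inf_lt[z [/= M' [mM' AM'] sMz zAe]] : (nu A < nu A + (e / 2)%:E)%E.
  by rewrite lte_spaddre ?lte_fin ?divr_gt0// ge0_fin_numE.
have /choice[M MP] n := lebesgue_stieltjes_open_cover
  (divr_gt0 (divr_gt0 e0 (ltr0n R 2)) (exprn_gt0 n.+1 (ltr0n R 2))) (mM' n).
pose U := \bigcup_n M n.
have oU : open U by apply: bigcup_open => n _; case: (MP n).
apply: (@le_trans _ _ (nu U)).
  apply: ereal_inf_lbound; exists U => //; split=> //.
  by apply: (subset_trans AM') => x [n _ M'x]; exists n => //; case: (MP n) => _ + _; apply.
apply: (@le_trans _ _ (\sum_(n <oo) nu (M n))%E).
  exact: outer_measure_sigma_subadditive.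
apply: (@le_trans _ _ (\sum_(n <oo) (wlength f (M' n) + (e / 2 / (2 ^ n.+1)%:R)%:E))%E).
  by apply: lee_nneseries => // n _; case: (MP n) => _ _; rewrite natrX.
apply: le_trans; first by apply: epsilon_trick => //; rewrite divr_ge0// ltW.
rewrite [in leRHS](splitr e) EFinD addeA leeD2r//.
by rewrite sMz ltW.
Qed.

Lemma lebesgue_stieltjes_inner (U : set R) : open U ->
  nu U = ereal_sup [set nu K | K in [set K : set R | compact K /\ K `<=` U]].
Proof.
move=> oU; have mU : measurable (U : set (measurableTypeR R)) by exact: open_measurable.
apply/eqP; rewrite eq_le; apply/andP; split; last first.
  apply: ge_ereal_sup => _ [K [cK KU] <-].
  by apply: le_measure => //; rewrite inE//; exact: compact_measurable.
(* Compact exhaustion: [K n] keeps the points of [[- n, n]] at distance at least [1/(n+1)] from the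
   complement of [U]; continuity from below concludes. *)
pose V n := \bigcup_(y in ~` U) ball y (n.+1%:R^-1 : R).
pose K n : set R := `[- n%:R, n%:R] `&` ~` V n.
have cK n : compact (K n).
  apply: (subclosed_compact _ (@segment_compact _ (- n%:R) n%:R)) => //.
    apply: closedI; first exact: interval_closed.
    by apply: open_closedC; apply: bigcup_open => y _; exact: ball_open.
  by move=> x [].
have KU n : K n `<=` U.
  by move=> x [_ nVx]; apply: contrapT => nUx; apply: nVx; exists x => //; exact: ballxx.
have -> : U = \bigcup_n K n.
  apply/seteqP; split=> [x Ux|x [n _]]; last exact: KU.
  have [d /= d0 dU] := (nbhs_ballP x U).1 (open_nbhs_nbhs (conj oU Ux)).
  have [n nP] : exists n, `|x| <= n%:R /\ n.+1%:R^-1 < d.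
    near \oo => n; exists n; split; near: n; first exact: nbhs_infty_ger.
    exact: near_infty_natSinv_lt (PosNum d0).
  case: nP => xn nd; exists n => //; split; first by rewrite /= in_itv/= -ler_norml.
  move=> [y nUy yx]; apply: nUy; apply: dU; apply: ball_sym.
  by apply: le_ball yx; exact: ltW.
have ndK : {homo K : n m / (n <= m)%N >-> (n <= m)%O}.
  move=> n m nm; apply/subsetPset => x [xn nVx]; split.
    have : (n%:R : R) <= m%:R by rewrite ler_nat.
    by move: xn; rewrite /= !in_itv/= => /andP[? ?] ?; apply/andP; split; lra.
  move=> [y nUy yx]; apply: nVx; exists y => //; apply: le_ball yx.
  by rewrite lef_pV2 ?posrE// ler_nat.
have mK n : measurable (K n : set (measurableTypeR R)) by exact: compact_measurable.
have cv : nu (K n) @[n --> \oo] --> nu (\bigcup_n K n).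
  by apply: nondecreasing_cvg_mu => //; exact: bigcup_measurable.
rewrite -(cvg_lim _ cv)//; apply: lime_le; first by apply/cvg_ex; eexists; exact: cv.
apply: nearW => n; apply: ereal_sup_ubound; exists (K n) => //; split=> //.
by move=> x Kx; exists n.
Unshelve. all: by end_near. Qed.

End stieltjes.

(** * Invariance of the measure *)

Lemma sum_measure_exists {d} {T : measurableType d} {R : realType} {I : Type}
    (m : I -> {measure set T -> \bar R}) (s : seq I) :
  exists M : {measure set T -> \bar R},
    forall A, M A = (\sum_(i <- s) m i A)%E.
Proof.
elim: s => [|i s [M ME]]; first by exists mzero => A; rewrite big_nil.
by exists (measure_add (m i) M) => A;
  rewrite -[LHS]/(measure_add (m i) M A) measure_addE big_cons ME.
Qed.

(** Needed to apply uniqueness of measures to the dual transition of [nu]. *)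
Lemma dual_transition_measure {R : realType} (mu : homeo R -> R)
    (nu : {measure set (measurableTypeR R) -> \bar R}) :
  finitely_supported_probability mu ->
  exists M : {measure set (measurableTypeR R) -> \bar R},
    forall A, M A = dual_transition mu nu A.
Proof.
move=> [mu0 fmu _].
pose push g : {measure set (measurableTypeR R) -> \bar R} :=
  measure_function_pushforward__canonical__measure_function_Measure nu
    (measurable_homeo g).
have [M ME] := sum_measure_exists (fun g => mscale (NngNum (mu0 g)) (push g))
  (finmap.enum_fset (fset_set (mass_support mu))).
by exists M => A; rewrite ME /dual_transition fsbig_finite.
Qed.

(** Inversion permutes the support and preserves masses. Inverses are what pushforwards of intervals
    produce. *)
Lemma transition_symmetric {R : realType} (mu : homeo R -> R) (F : R -> R) (x : R) :
  symmetric_measure mu ->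
  transition mu F x = \sum_(g \in mass_support mu) mu g * F ((g^-1)%g x).
Proof.
move=> mu_sym; rewrite /transition (reindex_fsbig (fun g : homeo R => (g^-1)%g)
  (mass_support mu)); last first.
  split=> [g|g h _ _|g sg]; first exact: mass_supportV.
    exact: invg_inj.
  by exists (g^-1)%g; [exact: mass_supportV|rewrite invgK].
by apply: eq_fsbigr => g _; rewrite -mu_sym.
Qed.

Lemma lebesgue_stieltjes_invariant {R : realType} (mu : homeo R -> R)
    (f : cumulative R R) (c : R) :
  finitely_supported_probability mu -> symmetric_measure mu ->
  (forall x, transition mu f x - f x = c) ->
  invariant_measure mu (lebesgue_stieltjes_measure f).
Proof.
move=> mu_prob mu_sym fc.
have [M ME] := dual_transition_measure (lebesgue_stieltjes_measure f) mu_prob.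
move=> A mA; rewrite -ME; apply: lebesgue_stieltjes_measure_unique => //.
move=> X /ocitvP[->|[[x y] /= xy ->]]; first by rewrite !measure0.
have [_ fmu _] := mu_prob.
rewrite ME /dual_transition lebesgue_stieltjes_itv ?(ltW xy)//.
(* Since [P f - f] is constant, [f] and [P f] have equal increments; the terms then match interval
   by interval. *)
rewrite (_ : f y - f x = transition mu f y - transition mu f x); last first.
  by have := fc x; rewrite -(fc y); lra.
rewrite !transition_symmetric// !fsbig_finite//= -sumrB -sumEFin.
apply: eq_bigr => g _; rewrite /pushforward -mulrBr EFinM; congr (_ * _)%E.
rewrite -lebesgue_stieltjes_itv; last exact/ltW/homeo_inv_increasing.
have xE z : (homeo_inv g x < z) = (x < g z) by rewrite -(homeo_ltE g) homeo_invK.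
have yE z : (z <= homeo_inv g y) = (g z <= y) by rewrite -(homeo_leE g) homeo_invK.
congr (lebesgue_stieltjes_measure f _); apply/seteqP.
by split=> z; rewrite /= !in_itv/= xE yE.
Qed.

Theorem theorem5p1 (R : realType) (mu : homeo R -> R)
    (mu_prob : finitely_supported_probability mu)
    (mu_sym : symmetric_measure mu)
    (mu_irr : irreducible_measure mu) :
  exists nu : {measure set (measurableTypeR R) -> \bar R},
    [/\ radon_measure nu, nu setT <> 0%E & invariant_measure mu nu].
Proof.
have [F [a [b [ndF Fab FE]]]] := invariant_function_exists mu_prob mu_sym mu_irr.
pose f : cumulative R R := HB.pack (right_limit F)
  (isCumulative.Build R _ R (right_limit F) (right_limit_homo ndF)
    (right_continuous_right_limit ndF)).
exists (lebesgue_stieltjes_measure f); split.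
- split; first exact: lebesgue_stieltjes_compact.
    exact: lebesgue_stieltjes_outer.
  exact: lebesgue_stieltjes_inner.
- have a1b : a - 1 < b.
    by rewrite ltrBlDr (@lt_trans _ _ b) ?ltrDl// ltNge; apply/negP => /ndF;
      rewrite leNgt Fab.
  (* The endpoint [a] would not do, as [right_limit F a] may exceed [F a]; to the left of [a] it is
     at most [F a]. *)
  have nu0 : (0 < lebesgue_stieltjes_measure f `](a - 1)%R, b])%E.
    rewrite lebesgue_stieltjes_itv ?(ltW a1b)// lte_fin subr_gt0.
    apply: le_lt_trans (lt_le_trans Fab (right_limit_ge ndF b)).
    by apply: right_limit_le => //; rewrite ltrBlDr ltrDl.
  apply/eqP; rewrite gt_eqF// (lt_le_trans nu0)//.
  by apply: le_measure => //; rewrite inE.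
- apply: lebesgue_stieltjes_invariant => // x.
  exact: transition_right_limit mu_prob ndF FE.
Qed.
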